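(* Let $d\in\mathbb N$, $k\in\mathbb N\setminus\{1\}$, $\bm\rho\in\mathbb N^d$, let $\mathrm K=\{\kappa_1,\ldots,\kappa_k\}$ be a family of positive integer multiples of $\nu(\bm\rho)$ with $\sum_{i=1}^k\kappa_i=1$, let $\mathcal A=\{A_1,\ldots,A_k\}$ be a family of positive definite symmetric real $d\times d$ matrices, $S=\{s_1,\ldots,s_k\}\subset\mathbb R^d$ a set of $k$ sites, and let $\epsilon\in(0,\frac12]$. Let $I(\mathcal A)=(k,X(\bm\rho),\Omega(\bm\rho),\mathcal A,\mathrm K,S)$ be the corresponding instance of the weight-constrained anisotropic assignment problem and let $I(\mathcal E)=(k,X(\bm\rho),\Omega(\bm\rho),\mathcal E,\mathrm K,S)$, where $\mathcal E=\{E_d,\ldots,E_d\}$ consists of $k$ copies of the unit matrix. Further, let $(\tilde X,\tilde\Omega)$ be an $\frac{\epsilon}{3}$-resolution coreset for $I(\mathcal E)$, $g$ its extension, $\tilde C\in\mathcal C_{\mathrm K}(k,\tilde X,\tilde\Omega)$ and $C=g(\tilde C)$. If $\tilde C$ is a $\gamma$-approximation for $\tilde I(\mathcal E)=(k,\tilde X,\tilde\Omega,\mathcal E,\mathrm K,S)$, where $\gamma\ge1$, then $C$ is a $(1+\epsilon)\,\gamma\,\frac{\lambda^+(\mathcal A)}{\lambda^-(\mathcal A)}$-approximation for $I(\mathcal A)$.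
   Context: $\mathbb N=\{1,2,\ldots\}$, $[\ell]=\{1,\ldots,\ell\}$; vector inequalities are componentwise. Resolution sets. For $\bm\rho=(\rho_1,\ldots,\rho_d)\in\mathbb N^d$, $X(\bm\rho)\subset[0,1]^d$ is the set of the $2^{\rho_1+\cdots+\rho_d}$ points with $t$th coordinate $\frac{1}{2^{\rho_t+1}}+\frac{j_t-1}{2^{\rho_t}}$, $j_t\in[2^{\rho_t}]$, $t\in[d]$, and $\nu(\bm\rho)=2^{-\rho_1}\cdots2^{-\rho_d}$. $\Omega(\bm\rho)$ assigns weight $\nu(\bm\rho)$ to each point of $X(\bm\rho)$. Clusterings. For a weighted set $(X,\Omega)$ of points $x_1,\ldots,x_n\in\mathbb R^d$ with weights $\omega_1,\ldots,\omega_n>0$, a $k$-clustering is a vector $C=(\xi_{ij})_{i\in[k],j\in[n]}\in[0,1]^{kn}$ with $\sum_{i=1}^k\xi_{ij}=1$ for all $j$. $\mathcal C_{\mathrm K}(k,X,\Omega)$ is the set of $k$-clusterings with $\sum_j\xi_{ij}\omega_j=\kappa_i$ for all $i\in[k]$. Costs. With $\|x\|_{A}=\sqrt{x^TAx}$, $\mathrm{cost}_{\mathcal A}(X,C,S)=\sum_{i=1}^k\sum_{j=1}^n\xi_{ij}\omega_j\|x_j-s_i\|_{A_i}^2$ and $\mathrm{cost}_{\mathcal A}(X,S)=\min\{\mathrm{cost}_{\mathcal A}(X,C,S):C\in\mathcal C_{\mathrm K}(k,X,\Omega)\}$. For $\mathcal A=\mathcal E$ the subscript is dropped. A set of $k$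 sites is an indexed set of $k$ different points of $\mathbb R^d$. $\lambda^+(\mathcal A)$ and $\lambda^-(\mathcal A)$ denote the largest and smallest eigenvalue of all matrices in $\mathcal A$. Problem. Weight-constrained anisotropic assignment: given $(k,X,\Omega,\mathcal A,\mathrm K,S)$, find $C\in\mathcal C_{\mathrm K}(k,X,\Omega)$ minimizing $\mathrm{cost}_{\mathcal A}(X,C,S)$. $C\in\mathcal C_{\mathrm K}(k,X,\Omega)$ is a $\gamma$-approximation for this instance if $\mathrm{cost}_{\mathcal A}(X,C,S)\le\gamma\cdot\mathrm{cost}_{\mathcal A}(X,S)$. Coresets (Euclidean case). For $\eta\in(0,\frac12]$, $(\tilde X,\tilde\Omega)$ is an $\eta$-coreset for $(k,X,\Omega,\mathrm K)$ if there are a mapping $g:\mathcal C_{\mathrm K}(k,\tilde X,\tilde\Omega)\to\mathcal C_{\mathrm K}(k,X,\Omega)$ (called extension) and a real constant $\Delta\ge0$ such that for all sets $S'$ of $k$ sites and all $\tilde C'\in\mathcal C_{\mathrm K}(k,\tilde X,\tilde\Omega)$: (a) $(1-\eta)\,\mathrm{cost}(X,g(\tilde C'),S')\le\mathrm{cost}(\tilde X,\tilde C',S')+\Delta$, and (b) $\mathrm{cost}(\tilde X,S')+\Delta\le(1+\eta)\,\mathrm{cost}(X,S')$. It is an $\eta$-resolution coreset if in addition there is $\bm\tau\in\mathbb N^d$, $\bm\tau\le\bm\rho$, with $\tilde X=X(\bm\tau)$ and $\tilde\Omega=\Omega(\bm\tau)$. A coreset for the instance $I(\mathcal E)$ means a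 coreset for $(k,X(\bm\rho),\Omega(\bm\rho),\mathrm K)$ in this sense. *)

(* Defs.v *)
From HB Require Import structures.
From mathcomp Require Export all_boot all_order all_algebra.
From mathcomp Require Export finmap all_classical all_reals.

Export Order.TTheory GRing.Theory Num.Theory.

#[global] Open Scope classical_set_scope.
#[global] Open Scope ring_scope.

(* The minimum (maximum) of a set of reals, with default value 0 when the set
   has no least (greatest) element. *)
Definition set_min {R : realType} (E : set R) : R := xget 0 (E `&` lbound E).
Definition set_max {R : realType} (E : set R) : R := xget 0 (E `&` ubound E).

Record weighted_set (R : realType) (d : nat) := WeightedSet {
  wpoints :> {fset 'cV[R]_d};
  weight : wpoints -> R;
  weight_gt0 : forall x, 0 < weight x
}.
Arguments weight {R d w} x.
Arguments weight_gt0 {R d w} x.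

Definition nu (R : realType) {d : nat} (rho : 'I_d -> nat) : R :=
  \prod_(t < d) 2 ^- rho t.

Lemma nu_gt0 (R : realType) {d : nat} (rho : 'I_d -> nat) : 0 < nu R rho.
Proof. by apply: prodr_gt0 => t _; rewrite invr_gt0 exprn_gt0. Qed.

(* The index j t ranges over {0, ..., 2 ^ rho t - 1}, hence stands for j_t - 1
   when the j_t are numbered from 1. *)
Definition grid_point (R : realType) {d : nat} {rho : 'I_d -> nat}
    (j : {dffun forall t : 'I_d, 'I_(2 ^ rho t)}) : 'cV[R]_d :=
  \col_t (1 / 2 ^+ (rho t).+1 + (j t)%:R / 2 ^+ rho t).

Definition grid (R : realType) {d : nat} (rho : 'I_d -> nat) :
    {fset 'cV[R]_d} :=
  [fset grid_point R j | j : {dffun forall t : 'I_d, 'I_(2 ^ rho t)}]%fset.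

(* The pair (X(rho), Omega(rho)). *)
Definition resolution (R : realType) {d : nat} (rho : 'I_d -> nat) :
    weighted_set R d :=
  WeightedSet R d (grid R rho) (fun=> nu R rho) (fun=> nu_gt0 R rho).

(* The points of X are distinct, so the entries xi_ij can be indexed by the
   points themselves: C i x is the fraction of x assigned to cluster i. *)
Definition is_clustering {R : realType} {d k : nat} (X : weighted_set R d)
    (C : 'I_k -> X -> R) : Prop :=
  (forall i x, 0 <= C i x <= 1) /\ (forall x, \sum_(i < k) C i x = 1).

Definition clusterings {R : realType} {d k : nat} (X : weighted_set R d)
    (kappa : 'I_k -> R) : set ('I_k -> X -> R) :=
  [set C | is_clustering X C /\
           forall i, \sum_(x : X) C i x * weight x = kappa i].

Definition norm_mx {R : realType} {d : nat} (B : 'M[R]_d) (x : 'cV[R]_d) : R :=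
  Num.sqrt ((x^T *m B *m x) 0 0).

Definition cost {R : realType} {d k : nat} (A : 'I_k -> 'M[R]_d)
    (X : weighted_set R d) (C : 'I_k -> X -> R) (S : 'I_k -> 'cV[R]_d) : R :=
  \sum_(i < k) \sum_(x : X)
     C i x * weight x * norm_mx (A i) (\val x - S i) ^+ 2.

Definition min_cost {R : realType} {d k : nat} (A : 'I_k -> 'M[R]_d)
    (X : weighted_set R d) (kappa : 'I_k -> R) (S : 'I_k -> 'cV[R]_d) : R :=
  set_min [set cost A X C S | C in clusterings X kappa].

Definition is_approximation {R : realType} {d k : nat} (gamma : R)
    (X : weighted_set R d) (A : 'I_k -> 'M[R]_d) (kappa : 'I_k -> R)
    (S : 'I_k -> 'cV[R]_d) (C : 'I_k -> X -> R) : Prop :=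
  clusterings X kappa C /\ cost A X C S <= gamma * min_cost A X kappa S.

(* k copies of the unit matrix. *)
Definition euclid {R : realType} {d k : nat} : 'I_k -> 'M[R]_d := fun=> 1%:M.

Definition posdef_mx {R : realType} {d : nat} (B : 'M[R]_d) : Prop :=
  B \is symmetricmx /\ forall x : 'cV[R]_d, x != 0 -> 0 < (x^T *m B *m x) 0 0.

Definition eigenvalues {R : realType} {d k : nat} (A : 'I_k -> 'M[R]_d) :
    set R :=
  [set a | exists i, eigenvalue (A i) a].

Definition lambda_max {R : realType} {d k : nat} (A : 'I_k -> 'M[R]_d) : R :=
  set_max (eigenvalues A).
Definition lambda_min {R : realType} {d k : nat} (A : 'I_k -> 'M[R]_d) : R :=
  set_min (eigenvalues A).

(* g is an extension witnessing that Y is an eta-coreset for X; only its values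
   on clusterings Y kappa matter. A set of k sites is an injective family. *)
Definition is_extension {R : realType} {d k : nat} (eta : R)
    (Y X : weighted_set R d) (kappa : 'I_k -> R)
    (g : ('I_k -> Y -> R) -> ('I_k -> X -> R)) : Prop :=
  set_fun (clusterings Y kappa) (clusterings X kappa) g /\
  exists Delta : R, 0 <= Delta /\
    forall (S : 'I_k -> 'cV[R]_d) (C : 'I_k -> Y -> R),
      injective S -> clusterings Y kappa C ->
      (1 - eta) * cost euclid X (g C) S <= cost euclid Y C S + Delta /\
      min_cost euclid Y kappa S + Delta
        <= (1 + eta) * min_cost euclid X kappa S.

Definition is_coreset {R : realType} {d k : nat} (eta : R)
    (Y X : weighted_set R d) (kappa : 'I_k -> R) : Prop :=
  0 < eta <= 1 / 2 /\
  exists g : ('I_k -> Y -> R) -> ('I_k -> X -> R), is_extension eta Y X kappa g.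

Definition is_resolution_coreset {R : realType} {d k : nat} (eta : R)
    (Y : weighted_set R d) (rho : 'I_d -> nat) (kappa : 'I_k -> R) : Prop :=
  is_coreset eta Y (resolution R rho) kappa /\
  exists tau : 'I_d -> nat,
    (forall t, (0 < tau t <= rho t)%N) /\ Y = resolution R tau.

(* Main.v *)
Require Import Defs.
From mathcomp Require Import topology normedtype derive.
From mathcomp Require Import ring lra.
Import numFieldNormedType.Exports.

(** With eta = eps / 3, the two coreset inequalities and the approximation
    quality of C on the coarse instance give, for the Euclidean costs,

      (1 - eta) cost (g C) <= cost C + Delta <= gamma (min + Delta)
                           <= gamma (1 + eta) min',

    where min and min' are the optimal values on the coarse and on the fine
    set; the second step absorbs Delta because gamma >= 1 and Delta >= 0. As
    eta <= 1/3, the quotient (1 + eta) / (1 - eta) is at most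
    1 + 3 eta = 1 + eps, so g C is a (1 + eps) gamma-approximation for the
    Euclidean instance ([coreset_ratio]).

    Passing from the Euclidean to the anisotropic cost uses only the Rayleigh
    bounds lambda_min |x|^2 <= x^T A_i x <= lambda_max |x|^2
    ([lambda_minP], [lambda_maxP]), which carry over to costs term by term
    ([cost_qform_le]): the upper bound is applied to g C, the lower one to an
    optimal anisotropic clustering.

    Minima and maxima in the definitions default to 0 when they do not exist,
    so their existence is part of the argument. Two compactness facts are
    needed: an optimal clustering exists ([min_cost_attained]), and the
    Rayleigh quotient of a symmetric matrix attains its minimum on the unit
    sphere. Both are instances of [attains_min_in_box], an extreme value
    theorem for closed subsets of a box in a product of copies of R. That the
    minimum of the Rayleigh quotient is an eigenvalue ([rayleigh_min]) follows
    from the fact that a null vector of a positive semidefinite form lies in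
    the kernel of its matrix ([psd_ker]). *)

(** * Least and greatest elements *)

Lemma set_minE {R : realType} (E : set R) (m : R) :
  E m -> lbound E m -> set_min E = m.
Proof.
move=> Em lbm; rewrite /set_min.
have [Ex lbx] : (E `&` lbound E) (xget 0 (E `&` lbound E)).
  by apply: xgetPex; exists m.
by apply/eqP; rewrite eq_le lbx //= lbm.
Qed.

Lemma set_maxE {R : realType} (E : set R) (m : R) :
  E m -> ubound E m -> set_max E = m.
Proof.
move=> Em ubm; rewrite /set_max.
have [Ex ubx] : (E `&` ubound E) (xget 0 (E `&` ubound E)).
  by apply: xgetPex; exists m.
by apply/eqP; rewrite eq_le ubx //= ubm.
Qed.

(** * Minima over closed subsets of a box *)

Lemma continuous_sum {R : realType} {T : topologicalType} {J : finType}
    (F : J -> T -> R) :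
  (forall j, continuous (F j)) -> continuous (fun u => \sum_j F j u).
Proof.
by move=> cF; apply: continuous_big => // -[a b]; exact: add_continuous.
Qed.

Section Box.
Variables (R : realType) (I : eqType).
Local Notation prodI := (prod_topology (fun _ : I => R)).

Lemma eval_continuous (i : I) : continuous (fun u : prodI => u i).
Proof. exact: (@proj_continuous I (fun=> R)). Qed.

Lemma closed_forall {J : Type} (P : J -> set prodI) :
  (forall j, closed (P j)) -> closed [set u | forall j, P j u].
Proof.
move=> clP; rewrite (_ : [set u | _] = \bigcap_j P j); first exact: closed_bigI.
by apply/seteqP; split=> u Pu j *; exact: Pu.
Qed.

Lemma closed_level (f : prodI -> R) (c : R) :
  continuous f -> closed [set u | f u = c].
Proof.
move=> cf; apply: (@preimage_closed _ _ f [set x | x = c]); last exact: closed_eq.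
by move=> u _; exact: cf.
Qed.

Lemma closed_superlevel (f : prodI -> R) (c : R) :
  continuous f -> closed [set u | c <= f u].
Proof.
move=> cf; apply: (@preimage_closed _ _ f [set x | c <= x]); last exact: closed_ge.
by move=> u _; exact: cf.
Qed.

Lemma closed_sublevel (f : prodI -> R) (c : R) :
  continuous f -> closed [set u | f u <= c].
Proof.
move=> cf; apply: (@preimage_closed _ _ f [set x | x <= c]); last exact: closed_le.
by move=> u _; exact: cf.
Qed.

(** The box is compact by Tychonoff's theorem. Working with functions on an
    arbitrary index type rather than with vectors lets the same lemma serve
    for the unit sphere (indices are coordinates) and for clusterings (indices
    are pairs of a cluster and a point). *)
Lemma attains_min_in_box (a b : R) (K : set prodI) (f : prodI -> R) :
  K !=set0 -> closed K -> (forall u, K u -> forall i, a <= u i <= b) ->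
  continuous f -> exists2 c, K c & forall u, K u -> f c <= f u.
Proof.
move=> K0 clK Kab cf.
have cK : compact K.
  have cbox : compact ([set u | forall i, `[a, b]%classic (u i)] : set prodI).
    apply: (@tychonoff I (fun=> R) (fun=> `[a, b]%classic)) => i.
    exact: segment_compact.
  apply: (subclosed_compact clK cbox) => u Ku i /=.
  by rewrite in_itv /=; exact: Kab.
have [|c /set_mem Kc minc] := compact_EVT_min K0 cK (f := f).
  exact: continuous_subspaceT.
by exists c => // u Ku; apply: minc; exact: mem_set.
Qed.
End Box.

(** * Quadratic forms and the Rayleigh quotient *)

Definition qform {R : realType} {d : nat} (B : 'M[R]_d) (x : 'cV[R]_d) : R :=
  (x^T *m B *m x) 0 0.

Section Qform.
Variables (R : realType) (d : nat).
Implicit Types (B : 'M[R]_d) (x v w : 'cV[R]_d).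

Lemma qform_sum B x : qform B x = \sum_j (\sum_i x i 0 * B i j) * x j 0.
Proof.
by rewrite /qform mxE; apply: eq_bigr => j _; rewrite mxE;
  congr (_ * _); apply: eq_bigr => i _; rewrite mxE.
Qed.

Lemma qform1 x : qform 1%:M x = \sum_i x i 0 ^+ 2.
Proof.
by rewrite /qform mulmx1 mxE; apply: eq_bigr => i _; rewrite mxE expr2.
Qed.

Lemma qform1_ge0 x : 0 <= qform 1%:M x.
Proof. by rewrite qform1 sumr_ge0 // => i _; exact: sqr_ge0. Qed.

Lemma qform1_eq0 x : (qform 1%:M x == 0) = (x == 0).
Proof.
apply/idP/eqP => [|->]; last by rewrite /qform mulmx0 mxE.
rewrite qform1 psumr_eq0 => [/allP x0|i _]; last exact: sqr_ge0.
apply/colP => i; rewrite mxE; apply/eqP.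
by move: (x0 i (mem_index_enum _)); rewrite sqrf_eq0.
Qed.

Lemma qform1_gt0 x : x != 0 -> 0 < qform 1%:M x.
Proof. by move=> x0; rewrite lt0r qform1_eq0 x0 qform1_ge0. Qed.

Lemma qformBl B a x : qform (B - a%:M) x = qform B x - a * qform 1%:M x.
Proof.
by rewrite /qform mulmxBr mulmxBl mul_mx_scalar mulmx1 -scalemxAl !mxE.
Qed.

Lemma qformN B x : qform (- B) x = - qform B x.
Proof. by rewrite /qform mulmxN mulNmx mxE. Qed.

Lemma qformZ B a x : qform B (a *: x) = a ^+ 2 * qform B x.
Proof.
rewrite /qform (_ : (a *: x)^T = a *: x^T); last by rewrite linearZ.
by rewrite -!scalemxAl -scalemxAr scalerA mxE expr2.
Qed.

Lemma sym_tr B : B \is symmetricmx -> B^T = B.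
Proof.
move/is_hermitianmxP => {2}->; rewrite expr0 scale1r.
by apply/matrixP => i j; rewrite !mxE.
Qed.

(** Let w = B v. The form is nonnegative at v - t w for every t, that is,
    0 <= t^2 (w^T B w) - 2 t |w|^2; for small t > 0 the linear term dominates
    unless w = 0. *)
Lemma psd_ker B v : B^T = B -> (forall x, 0 <= qform B x) ->
  qform B v = 0 -> B *m v = 0.
Proof.
move=> symB psdB Bv0; set w := B *m v.
set q := qform B w; set a := qform 1%:M w.
have expand t : qform B (v - t *: w) = t ^+ 2 * q - 2 * t * a.
  have trw : w^T = v^T *m B by rewrite /w trmx_mul symB.
  have Bv0' : (v^T *m B *m v) 0 0 = 0 by [].
  rewrite /q /a /qform (_ : (v - t *: w)^T = v^T - t *: w^T); last first.
    by rewrite linearB linearZ.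
  rewrite mulmxBl -scalemxAl mulmxBl -!scalemxAl !mulmxBr -!scalemxAr -trw mulmx1.
  rewrite -(mulmxA w^T B v) -/w.
  by move: Bv0'; rewrite -trw !mxE => ->; ring.
apply/eqP; rewrite -qform1_eq0 -/a; apply/negPn/negP => a0.
have q0 : 0 <= q by exact: psdB.
have := psdB (v - (a / (q + 1)) *: w); rewrite expand.
have q1 : 0 < q + 1 by lra.
(* This t minimizes the bound up to replacing q by q + 1, which avoids a
   division by zero when q = 0. *)
have -> : (a / (q + 1)) ^+ 2 * q - 2 * (a / (q + 1)) * a =
   - ((a / (q + 1)) ^+ 2 * (q + 2)) by field; rewrite gt_eqF.
rewrite oppr_ge0 leNgt => /negP; apply; apply: mulr_gt0; last by lra.
by rewrite exprn_even_gt0 //= mulf_neq0 // invr_neq0 // gt_eqF.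
Qed.

(** The columns are given by functions, as this is the shape in which
    [attains_min_in_box] provides its points. *)
Lemma qform_continuous B :
  continuous (fun u : prod_topology (fun _ : 'I_d => R) => qform B (\col_i u i)).
Proof.
rewrite (_ : (fun u => _) = fun u => \sum_j (\sum_i u i * B i j) * u j).
  apply: continuous_sum => j u.
  apply: continuousM; last exact: eval_continuous.
  apply: continuous_sum => i {}u.
  by apply: continuousM; [exact: eval_continuous | exact: cst_continuous].
apply/funext => u; rewrite qform_sum; apply: eq_bigr => j _; rewrite mxE.
by congr (_ * _); apply: eq_bigr => i _; rewrite mxE.
Qed.

(** A minimizer v of the form on the unit sphere, with value m, is an
    eigenvector for m: the form of B - m is positive semidefinite and vanishes
    at v, so [psd_ker] yields B v = m v. *)
Lemma rayleigh_min B : (0 < d)%N -> B^T = B ->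
  exists2 m, eigenvalue B m & forall x, m * qform 1%:M x <= qform B x.
Proof.
move=> d0 symB.
pose vec (u : 'I_d -> R) : 'cV[R]_d := \col_i u i.
have [||||u Ku minu] := @attains_min_in_box R _ (-1) 1
    [set u | qform 1%:M (vec u) = 1] (fun u => qform B (vec u)).
(* The first unit vector shows that the sphere is nonempty. *)
- exists (fun i => (i == Ordinal d0)%:R) => /=; rewrite qform1.
  rewrite (bigD1 (Ordinal d0)) //= big1 => [|i /negPf i0].
    by rewrite mxE eqxx addr0 expr1n.
  by rewrite mxE i0 expr0n.
- by apply: closed_level; exact: qform_continuous.
- move=> u /= Ku i.
  rewrite -ler_norml -(@expr_le1 _ 2) // -normrX ger0_norm ?sqr_ge0 //.
  move: Ku; rewrite qform1 (bigD1 i) //= mxE => <-.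
  by rewrite lerDl sumr_ge0 // => j _; exact: sqr_ge0.
- exact: qform_continuous.
set v := vec u; set m := qform B v.
have mP x : m * qform 1%:M x <= qform B x.
  have [->|x0] := eqVneq x 0; first by rewrite /qform !mulmx0 mxE mulr0.
  have x1 := qform1_gt0 x x0; set r := Num.sqrt (qform 1%:M x).
  have r2 : r ^+ 2 = qform 1%:M x by rewrite sqr_sqrtr // ltW.
  have r0 : 0 < r by rewrite sqrtr_gt0.
  have vecE : vec (fun i => (r^-1 *: x) i 0) = r^-1 *: x.
    by apply/colP => i; rewrite mxE.
  (* Homogeneity reduces the bound at x to the one at x / |x|. *)
  have := minu (fun i => (r^-1 *: x) i 0); rewrite /= !vecE !qformZ exprVn r2.
  rewrite mulVf ?gt_eqF // => /(_ erefl).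
  by rewrite mulrC ler_pdivlMr.
exists m => //; apply/eigenvalueP; exists v^T.
  have Nv : (B - m%:M) *m v = 0.
    apply: psd_ker => [|x|].
    - by rewrite linearB /= symB tr_scalar_mx.
    - by rewrite qformBl subr_ge0.
    - by rewrite qformBl -/m Ku mulr1 subrr.
  move/eqP: Nv; rewrite mulmxBl subr_eq0 mul_scalar_mx => /eqP Bv.
  by rewrite -[B in LHS]symB -trmx_mul Bv linearZ.
rewrite trmx_eq0 -qform1_eq0; move: Ku => /= ->; exact: oner_neq0.
Qed.

Lemma rayleigh_max B : (0 < d)%N -> B^T = B ->
  exists2 m, eigenvalue B m & forall x, qform B x <= m * qform 1%:M x.
Proof.
move=> d0 symB.
have symN : (- B)^T = - B by rewrite linearN /= symB.
have [m /eigenvalueP[v vB v0] mP] := rayleigh_min (- B) d0 symN.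
exists (- m) => [|x].
  apply/eigenvalueP; exists v => //.
  by apply: oppr_inj; rewrite -mulmxN vB scaleNr opprK.
by rewrite mulNr lerNr -qformN.
Qed.

Lemma eigenvalue_qform B a : eigenvalue B a ->
  exists2 v, v != 0 & qform B v = a * qform 1%:M v.
Proof.
move=> /eigenvalueP[v vB v0]; exists v^T; first by rewrite trmx_eq0.
by rewrite /qform trmxK vB mulmx1 -scalemxAl mxE.
Qed.

End Qform.

(** * Extreme eigenvalues of a family *)

Section Lambda.
Variables (R : realType) (d k : nat) (A : 'I_k -> 'M[R]_d).
Hypotheses (d0 : (0 < d)%N) (k0 : (0 < k)%N).
Hypothesis symA : forall i, (A i)^T = A i.

(** The least of the finitely many Rayleigh minima is an eigenvalue, and it is
    below every other one, since an eigenvalue is the Rayleigh quotient at its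
    eigenvector. The Rayleigh bound for the whole family comes with it. *)
Lemma lambda_minP : eigenvalues A (lambda_min A) /\
  forall i x, lambda_min A * qform 1%:M x <= qform (A i) x.
Proof.
have /boolp.choice[M MP] : forall i, exists m, eigenvalue (A i) m /\
    forall x, m * qform 1%:M x <= qform (A i) x.
  by move=> i; have [m ? ?] := rayleigh_min _ _ (A i) d0 (symA i); exists m.
case: (@arg_minP _ _ _ (Ordinal k0) xpredT M erefl) => i _ minM.
have -> : lambda_min A = M i.
  apply: set_minE; first by exists i; exact: (MP i).1.
  move=> a [j /eigenvalue_qform[v v0 va]].
  rewrite -(ler_pM2r (qform1_gt0 _ _ v v0)) -va (le_trans _ ((MP j).2 v)) //.
  by apply: ler_wpM2r; [exact: qform1_ge0 | exact: minM].
split=> [|j x]; first by exists i; exact: (MP i).1.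
apply: le_trans _ ((MP j).2 x).
by apply: ler_wpM2r; [exact: qform1_ge0 | exact: minM].
Qed.

Lemma lambda_maxP : eigenvalues A (lambda_max A) /\
  forall i x, qform (A i) x <= lambda_max A * qform 1%:M x.
Proof.
have /boolp.choice[M MP] : forall i, exists m, eigenvalue (A i) m /\
    forall x, qform (A i) x <= m * qform 1%:M x.
  by move=> i; have [m ? ?] := rayleigh_max _ _ (A i) d0 (symA i); exists m.
case: (@arg_maxP _ _ _ (Ordinal k0) xpredT M erefl) => i _ maxM.
have -> : lambda_max A = M i.
  apply: set_maxE; first by exists i; exact: (MP i).1.
  move=> a [j /eigenvalue_qform[v v0 va]].
  rewrite -(ler_pM2r (qform1_gt0 _ _ v v0)) -va (le_trans ((MP j).2 v)) //.
  by apply: ler_wpM2r; [exact: qform1_ge0 | exact: maxM].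
split=> [|j x]; first by exists i; exact: (MP i).1.
apply: le_trans ((MP j).2 x) _.
by apply: ler_wpM2r; [exact: qform1_ge0 | exact: maxM].
Qed.
End Lambda.

Lemma eigenvalues_posdef_gt0 {R : realType} {d k : nat} (A : 'I_k -> 'M[R]_d)
    (a : R) :
  (forall i, posdef_mx (A i)) -> eigenvalues A a -> 0 < a.
Proof.
move=> pdA [i /eigenvalue_qform[v v0 va]].
by rewrite -(pmulr_lgt0 _ (qform1_gt0 _ _ v v0)) -va; exact: (pdA i).2.
Qed.

(** * Costs of clusterings *)

Section Cost.
Variables (R : realType) (d k : nat) (X : weighted_set R d).
Implicit Types (A : 'I_k -> 'M[R]_d) (S : 'I_k -> 'cV[R]_d).
Implicit Types (C : 'I_k -> X -> R) (kappa : 'I_k -> R).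

(** The clusterings with prescribed weights form a closed subset of the unit
    cube, on which the cost is a continuous (indeed linear) function; hence the minimum exists as soon as
    there is a clustering at all. *)
Lemma min_cost_attained A kappa S C : clusterings X kappa C ->
  exists2 C0, clusterings X kappa C0 & min_cost A X kappa S = cost A X C0 S /\
    forall C', clusterings X kappa C' -> min_cost A X kappa S <= cost A X C' S.
Proof.
move=> XC; pose prodX := prod_topology (fun _ : 'I_k * X => R).
pose cl (u : 'I_k * X -> R) i x := u (i, x).
have [||||u Ku minu] := @attains_min_in_box R _ 0 1
    [set u | clusterings X kappa (cl u)] (fun u => cost A X (cl u) S).
- by exists (fun p => C p.1 p.2).
- rewrite (_ : [set u | _] =
      [set u | forall p, 0 <= u p] `&` [set u | forall p, u p <= 1]
      `&` [set u | forall x : X, \sum_i u (i, x) = 1]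
      `&` [set u | forall i, \sum_(x : X) u (i, x) * weight x = kappa i]).
    do !apply: closedI; apply: closed_forall => p.
    + by apply: closed_superlevel; exact: eval_continuous.
    + by apply: closed_sublevel; exact: eval_continuous.
    + by apply/closed_level/continuous_sum => i; exact: eval_continuous.
    + apply/closed_level/continuous_sum => x u.
      by apply: continuousM; [exact: eval_continuous | exact: cst_continuous].
  apply/seteqP; split=> u /=.
    move=> [[u01 u1] uk]; do !split=> //.
      by move=> [i x]; have /andP[] := u01 i x.
    by move=> [i x]; have /andP[] := u01 i x.
  by move=> [[[u0 u1] us] uk]; split=> //; split=> // i x; rewrite /cl u0 u1.
- by move=> u [[u01 _] _] [i x]; exact: (u01 i x).
- apply: continuous_sum => i; apply: continuous_sum => x u.
  have cw : {for u, continuous (fun v : prodX => v (i, x) * weight x)}.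
    by apply: continuousM; [exact: eval_continuous | exact: cst_continuous].
  exact: (continuousM cw (@cst_continuous _ _ _ u)).
have minE : min_cost A X kappa S = cost A X (cl u) S.
  apply: set_minE; first by exists (cl u).
  by move=> _ [C' XC' <-]; exact: (minu (fun p => C' p.1 p.2)).
exists (cl u) => //; rewrite minE; split=> // C' XC'.
exact: (minu (fun p => C' p.1 p.2)).
Qed.

(** The two factors a and a' allow one lemma to give both directions of the
    comparison between Euclidean and anisotropic costs, as well as the
    nonnegativity of costs (a = 0). *)
Lemma cost_qform_le A A' (a a' : R) C S :
  (forall i x, 0 <= C i x <= 1) ->
  (forall i x, 0 <= qform (A i) x) -> (forall i x, 0 <= qform (A' i) x) ->
  (forall i x, a * qform (A i) x <= a' * qform (A' i) x) ->
  a * cost A X C S <= a' * cost A' X C S.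
Proof.
move=> C01 A0 A'0 le; rewrite !mulr_sumr; apply: ler_sum => i _.
rewrite !mulr_sumr; apply: ler_sum => x _.
rewrite !sqr_sqrtr; [|exact: A'0|exact: A0].
rewrite [leLHS]mulrCA [leRHS]mulrCA; apply: ler_wpM2l; last exact: le.
by rewrite mulr_ge0 ?(ltW (weight_gt0 x)) //; have /andP[] := C01 i x.
Qed.
End Cost.

(** * Transfer of the approximation factor *)

(** Here c and cY stand for the costs of the extended and of the coarse
    clustering, m and mY for the two optimal values. The bound on eta is what
    makes 1 + eta <= (1 - eta) (1 + 3 eta) true. *)
Lemma coreset_ratio {R : realFieldType} (eta gamma c cY m mY Delta : R) :
  0 < eta -> eta <= 1 / 3 -> 1 <= gamma -> 0 <= Delta -> 0 <= m ->
  (1 - eta) * c <= cY + Delta -> cY <= gamma * mY ->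
  mY + Delta <= (1 + eta) * m ->
  c <= (1 + 3 * eta) * gamma * m.
Proof.
move=> eta0 eta3 gamma1 Delta0 m0 cX cY_le mX.
have eta1 : 0 < 1 - eta by lra.
rewrite -(ler_pM2l eta1); apply: le_trans cX _.
have gDelta : Delta <= gamma * Delta by rewrite ler_peMl.
have /(ler_wpM2l (ltW (lt_le_trans ltr01 gamma1))) gmX := mX.
have step : (1 + eta) * (gamma * m) <= (1 - eta) * (1 + 3 * eta) * (gamma * m).
  apply: ler_wpM2r; first by rewrite mulr_ge0 //; lra.
  nra.
lra.
Qed.

Theorem theorem2 (R : realType) (d k : nat) (rho : 'I_d -> nat)
    (kappa : 'I_k -> R) (A : 'I_k -> 'M[R]_d) (S : 'I_k -> 'cV[R]_d)
    (eps : R) (Y : weighted_set R d)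
    (g : ('I_k -> Y -> R) -> ('I_k -> resolution R rho -> R))
    (C : 'I_k -> Y -> R) (gamma : R) :
  (0 < d)%N ->
  (1 < k)%N ->
  (forall t, (0 < rho t)%N) ->
  (forall i, exists m : nat, (0 < m)%N /\ kappa i = m%:R * nu R rho) ->
  \sum_(i < k) kappa i = 1 ->
  (forall i, posdef_mx (A i)) ->
  injective S ->
  0 < eps <= 1 / 2 ->
  is_resolution_coreset (eps / 3) Y rho kappa ->
  is_extension (eps / 3) Y (resolution R rho) kappa g ->
  clusterings Y kappa C ->
  1 <= gamma ->
  is_approximation gamma Y euclid kappa S C ->
  is_approximation ((1 + eps) * gamma * (lambda_max A / lambda_min A))
    (resolution R rho) A kappa S (g C).
Proof.
move=> d0 k1 _ _ _ pdA injS /andP[eps0 eps1] _ [gXY [Delta [Delta0 ext]]].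
move=> YC gamma1 [_ apxC].
have XgC : clusterings (resolution R rho) kappa (g C) by exact: gXY.
split=> //; set X := resolution R rho in XgC *.
have [coreC corem] := ext S C injS YC.
have k0 : (0 < k)%N by exact: ltnW.
have symA i : (A i)^T = A i by apply: sym_tr; exact: (pdA i).1.
have [/(eigenvalues_posdef_gt0 _ _ pdA) lmin0 lminP] := lambda_minP _ _ _ A d0 k0 symA.
have [/(eigenvalues_posdef_gt0 _ _ pdA) lmax0 lmaxP] := lambda_maxP _ _ _ A d0 k0 symA.
have A0 i x : 0 <= qform (A i) x.
  have [->|x0] := eqVneq x 0; first by rewrite /qform mulmx0 mxE.
  by apply/ltW; exact: (pdA i).2.
have E0 (i : 'I_k) x : 0 <= qform (@euclid R d k i) x by exact: qform1_ge0.
have [CE XCE [minE minE_le]] := min_cost_attained _ _ _ X euclid kappa S _ XgC.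
have [CA XCA [minA _]] := min_cost_attained _ _ _ X A kappa S _ XgC.
have mE0 : 0 <= min_cost euclid X kappa S.
  have := cost_qform_le _ _ _ X euclid euclid 0 1 CE S XCE.1.1 E0 E0.
  by rewrite mul0r mul1r minE; apply=> i x; rewrite mul0r mul1r; exact: E0.
have ratio : cost euclid X (g C) S <= (1 + eps) * gamma * min_cost euclid X kappa S.
  rewrite [eps in X in _ <= X](_ : eps = 3 * (eps / 3)); last by field.
  by apply: coreset_ratio Delta0 mE0 coreC apxC corem; lra.
have upper : cost A X (g C) S <= lambda_max A * cost euclid X (g C) S.
  rewrite -[leLHS]mul1r; apply: cost_qform_le => //; first exact: XgC.1.1.
  by move=> i x; rewrite mul1r; exact: lmaxP.
have lower : lambda_min A * min_cost euclid X kappa S <= min_cost A X kappa S.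
  rewrite minA -[leRHS]mul1r.
  apply: le_trans (ler_wpM2l (ltW lmin0) (minE_le _ XCA)) _.
  apply: cost_qform_le => //; first exact: XCA.1.1.
  by move=> i x; rewrite mul1r; exact: lminP.
apply: le_trans upper _.
apply: le_trans (ler_wpM2l (ltW lmax0) ratio) _.
rewrite mulrC -!mulrA ler_wpM2l //; first by lra.
rewrite ler_wpM2l //; first by lra.
rewrite mulrC ler_wpM2l //; first exact: ltW.
by rewrite ler_pdivlMl.
Qed.
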